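(* For $n\geq 1$, $$\sum_{\sigma\in \mathfrak{D}_n}q^{\operatorname{inv}\sigma}t^{\operatorname{exc} \sigma}=\sum_{0\leq k\leq n/2} \Big(\sum_{\sigma\in \mathrm{DE}_{n,k}}q^{\operatorname{inv}\sigma}\Big) t^k (1+t)^{n-2k}.$$
   Context: $\mathfrak{S}_n$ is the set of permutations of $[n]=\{1,\dots,n\}$ and $\mathfrak{D}_n\subseteq\mathfrak{S}_n$ is the set of derangements (permutations with no fixed point $\sigma(i)=i$). $\operatorname{exc}\sigma=\#\{i\in[n]: i<\sigma(i)\}$ and $\operatorname{inv}\sigma=\#\{(i,j): i<j,\ \sigma(i)>\sigma(j)\}$. $\operatorname{cda}\sigma$ (number of cyclic double ascents, or double excedances) is the number of $i\in[n]$ with $i<\sigma(i)<\sigma^2(i)$. $\mathrm{DE}_{n,k}=\{\sigma\in\mathfrak{D}_n:\operatorname{exc}\sigma=k,\ \operatorname{cda}\sigma=0\}$. *)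

(* Defs.v *)
From mathcomp Require Import all_boot all_fingroup all_algebra.

Set Implicit Arguments.
Unset Strict Implicit.
Unset Printing Implicit Defensive.

(* Permutations of [n] are 'S_n, acting on 'I_n = {0, ..., n-1}; shifting the
   indices by one preserves all the order comparisons below. *)

Definition derangements (n : nat) : {set 'S_n} :=
  [set s : 'S_n | [forall i : 'I_n, s i != i]].

Definition exc (n : nat) (s : 'S_n) : nat :=
  #|[set i : 'I_n | i < s i]|.

Definition invs (n : nat) (s : 'S_n) : nat :=
  #|[set ij : 'I_n * 'I_n | (ij.1 < ij.2) && (s ij.1 > s ij.2)]|.

(* cyclic double ascents, a.k.a. double excedances *)
Definition cda (n : nat) (s : 'S_n) : nat :=
  #|[set i : 'I_n | i < s i < s (s i)]|.

Definition DE (n k : nat) : {set 'S_n} :=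
  [set s in derangements n | (exc s == k) && (cda s == 0)].

(* Main.v *)
(* Call [i] a valley, double ascent, peak or double descent according to
   whether it is an excedance position and whether it is an excedance value; a
   derangement thus determines a word in four letters. The sum of q^inv over
   the derangements with a given word is computed by reading the word as a
   Motzkin path: at height h, the current letter is matched with one of h open
   positions or values, and the matched pair can be deleted from the permutation
   at the cost of a power of q independent of the rest. A double ascent and a
   double descent at height h contribute the same factor q^h [h]_q and leave
   the height unchanged, so replacing double ascents by double descents
   preserves the sum, and every double descent of a word without double ascents
   accounts for a factor 1 + t. Such a word of length n with k valleys has k
   peaks, hence n - 2k double descents. *)

Require Import Defs.
From mathcomp Require Import all_boot all_fingroup all_algebra.
From mathcomp Require Import zify ring.

Set Implicit Arguments.
Unset Strict Implicit.
Unset Printing Implicit Defensive.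

Import GRing.Theory.

Local Open Scope ring_scope.

(** * Inversions and the deletion of one entry *)

Lemma invsE n (s : 'S_n) :
  invs s = (\sum_(i < n) \sum_(j < n) ((i < j) && (s j < s i)))%N.
Proof.
rewrite /invs -sum1dep_card big_mkcond /= pair_big /=.
by apply: eq_bigr => -[i j] _ /=; case: ifP.
Qed.

(** The hypothesis puts every value below [j] to the right of position [i]. So all [i] entries on
    the left exceed [j], all [j] smaller values lie on the right, and these are the inversions of
    the deleted entry. *)
Lemma invs_lift_perm n (i j : 'I_n.+1) (s : 'S_n) :
    (forall k : 'I_n, (k < i)%N -> (j <= s k)%N) ->
  invs (lift_perm i j s) = (i + j + invs s)%N.
Proof.
move=> hij; rewrite !invsE (bigD1_ord i) //= (bigD1_ord i) //= ltnn add0n.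
under eq_bigr => l _ do rewrite lift_perm_id lift_perm_lift /=.
under [in X in (_ + X)%N]eq_bigr => k _.
  rewrite (bigD1_ord i) //= lift_perm_id lift_perm_lift /=.
  under eq_bigr => l _.
    rewrite lift_perm_lift /=.
    have -> : (bump i k < bump i l)%N = (k < l)%N by rewrite /bump; lia.
    have -> : (bump j (s l) < bump j (s k))%N = (s l < s k)%N.
      by rewrite /bump; lia.
    over.
  over.
rewrite big_split /= addnA; congr (_ + _)%N.
have cnt m : (m <= n)%N -> (\sum_(k < n) (k < m) = m)%N.
  by move=> lemn; rewrite -big_mkcond -(big_ord_widen _ (fun=> 1%N)) //
             sum_nat_const card_ord muln1.
rewrite addnC; congr (_ + _)%N.
  rewrite -[RHS]cnt -1?ltnS //; apply: eq_bigr => k _; congr nat_of_bool.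
  have := hij k; rewrite /bump; lia.
(* Reindexing by [s] counts entries by value: exactly [j] of them lie below [j]. *)
rewrite -[RHS]cnt -1?ltnS // [RHS](reindex_inj (@perm_inj _ s)) /=.
apply: eq_bigr => k _; congr nat_of_bool.
have := hij k; rewrite /bump; lia.
Qed.

Lemma lift_perm_inj n (i j : 'I_n.+1) : injective (lift_perm i j).
Proof.
move=> s s' eqs; apply/permP=> k; apply: (@lift_inj _ j).
by rewrite -!(lift_perm_lift i) eqs.
Qed.

Lemma lift_perm_onto n (i j : 'I_n.+1) (s : 'S_n.+1) :
  s i = j -> exists s', s = lift_perm i j s'.
Proof.
move=> si; have /fin_all_exists[f sE] k : exists l, s (lift i k) = lift j l.
  have: j != s (lift i k) by rewrite -si (inj_eq perm_inj) neq_lift.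
  by case/unlift_some=> l -> _; exists l.
have f_inj : injective f.
  by move=> k l eqkl; apply/(@lift_inj _ i)/(@perm_inj _ s); rewrite !sE eqkl.
exists (perm f_inj); apply/permP=> x; case: (unliftP i x) => [k|] ->.
  by rewrite lift_perm_lift permE sE.
by rewrite lift_perm_id.
Qed.

(** * Inversion sums with restricted positions *)

Section RestrictedInversionSum.

Variables (R : comNzRingType) (q : R).

Implicit Types (P : nat -> nat -> bool).

(* [P x y] says whether [s x = y] is allowed. *)
Definition rinv n P : R :=
  \sum_(s : 'S_n | [forall x : 'I_n, P x (s x)]) q ^+ invs s.

Lemma eq_rinv n P P' :
    (forall x y, (x < n)%N -> (y < n)%N -> P x y = P' x y) ->
  rinv n P = rinv n P'.
Proof.
move=> eqP; apply: eq_bigl => s; apply: eq_forallb => x.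
by rewrite eqP.
Qed.

Lemma rinv_lift n P (i j : 'I_n.+1) :
    (forall x y, (x < i)%N -> (y < j)%N -> P x y = false) ->
  \sum_(s : 'S_n.+1 | [forall x : 'I_n.+1, P x (s x)] && (s i == j))
    q ^+ invs s =
  (P i j)%:R * q ^+ (i + j) * rinv n (fun x y => P (bump i x) (bump j y)).
Proof.
move=> P0.
have allP (s : 'S_n) : [forall x : 'I_n.+1, P x (lift_perm i j s x)] =
    P i j && [forall x : 'I_n, P (bump i x) (bump j (s x))].
  apply/forallP/andP => [Ps | [Pij /forallP Ps] x].
    split; first by have := Ps i; rewrite lift_perm_id.
    by apply/forallP=> x; have := Ps (lift i x); rewrite lift_perm_lift.
  case: (unliftP i x) => [y|] ->; last by rewrite lift_perm_id.
  by rewrite lift_perm_lift Ps.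
transitivity (\sum_(s in [set lift_perm i j s | s : 'S_n &
    P i j && [forall x : 'I_n, P (bump i x) (bump j (s x))]]) q ^+ invs s).
  apply: eq_bigl => s.
  apply/andP/imsetP => [[Ps /eqP/lift_perm_onto[s' eqs]] | [s']].
    by exists s' => //; rewrite inE -allP -eqs.
  by rewrite inE -allP => Ps' ->; rewrite lift_perm_id.
rewrite big_imset /=; last by move=> s s' _ _; apply: lift_perm_inj.
rewrite /rinv big_distrr /=; case: (boolP (P i j)) => [Pij|nPij]; last first.
  by rewrite big_pred0 => [|s]; rewrite ?inE // big1 // => s _; rewrite !mul0r.
apply: eq_big => [s | s]; rewrite inE //= mul1r -exprD => /forallP Ps.
rewrite invs_lift_perm // => k ltki; rewrite leqNgt; apply/negP=> ltsj.
have := Ps k; rewrite /bump [(i <= k)%N]leqNgt ltki.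
by rewrite [(j <= _)%N]leqNgt ltsj P0.
Qed.

Definition qnat n : R := \sum_(i < n) q ^+ i.

Lemma mul_qnat a b n : a * qnat n * b = \sum_(i < n) a * q ^+ i * b.
Proof. by rewrite /qnat mulr_sumr mulr_suml. Qed.

(** Each choice [c < h] of the value at [i] costs [q ^+ (i + c)] and leaves the same restriction
    [P'], so the choices add up to a [q]-integer. *)
Lemma rinv_row n h (i : nat) P P' :
    (i <= n)%N -> (h <= n.+1)%N ->
    (forall x y, (x < i)%N -> (y < h)%N -> P x y = false) ->
    (forall y, (y <= n)%N -> P i y = (y < h)%N) ->
    (forall c x y, (c < h)%N -> (x < n)%N -> (y < n)%N ->
       P (bump i x) (bump c y) = P' x y) ->
  rinv n.+1 P = q ^+ i * qnat h * rinv n P'.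
Proof.
move=> lein lehn P0 Pi PP'; pose i' := Ordinal (lein : (i < n.+1)%N).
rewrite {1}/rinv (partition_big (fun s : 'S_n.+1 => s i') predT) //=.
rewrite mul_qnat.
rewrite (big_ord_widen _ (fun c => q ^+ i * q ^+ c * rinv n P') lehn).
rewrite [RHS]big_mkcond; apply: eq_bigr => c _.
have [ltch|lehc] := ltnP c h.
  rewrite rinv_lift => [|x y ltxi ltyc]; last first.
    by rewrite P0 // (ltn_trans ltyc).
  rewrite /= Pi ?leq_ord // ltch mul1r exprD; congr (_ * _).
  by apply: eq_rinv => x y ltxn ltyn; apply: PP'.
rewrite big_pred0 // => s; apply/negP=> /andP[/forallP/(_ i')/= Ps /eqP sic].
by move: Ps; rewrite sic Pi ?leq_ord // ltnNge lehc.
Qed.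

(** Transpose of [rinv_row]: here the choice is the position of the value [j]. *)
Lemma rinv_col n h (j : nat) P P' :
    (j <= n)%N -> (h <= n.+1)%N ->
    (forall x y, (x < h)%N -> (y < j)%N -> P x y = false) ->
    (forall x, (x <= n)%N -> P x j = (x < h)%N) ->
    (forall r x y, (r < h)%N -> (x < n)%N -> (y < n)%N ->
       P (bump r x) (bump j y) = P' x y) ->
  rinv n.+1 P = q ^+ j * qnat h * rinv n P'.
Proof.
move=> lejn lehn P0 Pj PP'; pose j' := Ordinal (lejn : (j < n.+1)%N).
rewrite {1}/rinv (partition_big (fun s : 'S_n.+1 => s^-1%g j') predT) //=.
rewrite mul_qnat.
rewrite (big_ord_widen _ (fun r => q ^+ j * q ^+ r * rinv n P') lehn).
rewrite [RHS]big_mkcond; apply: eq_bigr => r _.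
under eq_bigl => s do rewrite (canF_eq (permKV s)) [j' == _]eq_sym.
have [ltrh|lehr] := ltnP r h.
  rewrite rinv_lift => [|x y ltxr ltyj]; last first.
    by rewrite P0 // (ltn_trans ltxr).
  rewrite /= Pj ?leq_ord // ltrh mul1r addnC exprD; congr (_ * _).
  by apply: eq_rinv => x y ltxn ltyn; apply: PP'.
rewrite big_pred0 // => s; apply/negP=> /andP[/forallP/(_ r)/= Ps /eqP srj].
by move: Ps; rewrite srj Pj ?leq_ord // ltnNge lehr.
Qed.

(** * Deleting the letter after a prefix of valleys *)

(* The flags of an index tell whether it is an excedance position and whether it
   is an excedance value. *)
Definition letter : finType := (bool * bool)%type.

Definition valley : letter := (true, false).

Definition fits (w : seq letter) (x y : nat) : bool :=
  let a := (nth valley w x).1 in let b := (nth valley w y).2 in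
  [|| [&& x < y, a & b] | [&& y < x, ~~ a & ~~ b]]%N.

Definition word_rinv (w : seq letter) : R := rinv (size w) (fits w).

Lemma nth_valleys h (w : seq letter) x :
  nth valley (nseq h valley ++ w) x =
  if (x < h)%N then valley else nth valley w (x - h).
Proof. by rewrite nth_cat size_nseq nth_nseq if_same. Qed.

Lemma nth_valleys_bump h c (w : seq letter) x :
  nth valley (nseq h valley ++ c :: w) (bump h x) =
  nth valley (nseq h valley ++ w) x.
Proof.
rewrite !nth_valleys /bump; case: (leqP h x) => [lehx|ltxh].
  by rewrite add1n [(x.+1 < h)%N]ltnNge leqW //= subSn.
by rewrite add0n ltxh.
Qed.

Lemma nth_valleys_bump_lt h c (w : seq letter) r x : (r < h)%N ->
  nth valley (nseq h valley ++ c :: w) (bump r x) =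
  if x.+1 == h then c else nth valley (nseq h valley ++ w) x.
Proof.
move=> ltrh; rewrite !nth_valleys /bump; case: eqP => [eqxh|neqxh].
  have -> : (r <= x)%N by rewrite -ltnS eqxh.
  by rewrite add1n eqxh ltnn subnn.
case: (ltnP x h) => [ltxh|lehx].
  by have -> : ((r <= x) + x < h)%N by lia.
rewrite ltnNge (leq_trans lehx (leq_addl _ _)).
by rewrite (leq_trans (ltnW ltrh) lehx) /= subSn.
Qed.

(* A prefix of [h] valleys represents [h] positions and [h] values that are
   still to be matched with later ones. *)
Lemma word_rinv_double_ascent h w :
  word_rinv (nseq h valley ++ (true, true) :: w) =
  q ^+ h * qnat h * word_rinv (nseq h valley ++ w).
Proof.
rewrite /word_rinv !size_cat /= !size_nseq addnS; apply: rinv_col; try lia.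
- by move=> x y ltxh ltyh; rewrite /fits !nth_valleys ltxh ltyh /= !andbF.
- move=> x _; rewrite /fits !nth_valleys ltnn subnn /=.
  by case: ltngtP => //=; rewrite ?andbF ?andbT.
move=> r x y ltrh _ _; rewrite /fits nth_valleys_bump nth_valleys_bump_lt //.
(* With row [r] gone, the position of the double ascent has index [h - 1]. Its flag is that of a
   valley, so it replaces the deleted row and the height stays [h]. *)
have -> : (if x.+1 == h then (true, true)
           else nth valley (nseq h valley ++ w) x).1
        = (nth valley (nseq h valley ++ w) x).1.
  by case: eqP => // <-; rewrite nth_valleys ltnSn.
rewrite !nth_valleys /bump.
by case: (ltnP x h) => ltxh; case: (ltnP y h) => ltyh //=;
   rewrite ?andbF ?andbT //; lia.
Qed.

(** Mirror image of the double ascent: the position takes one of the [h] open values, and the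
    letter's own value becomes open instead. *)
Lemma word_rinv_double_descent h w :
  word_rinv (nseq h valley ++ (false, false) :: w) =
  q ^+ h * qnat h * word_rinv (nseq h valley ++ w).
Proof.
rewrite /word_rinv !size_cat /= !size_nseq addnS; apply: rinv_row; try lia.
- by move=> x y ltxh ltyh; rewrite /fits !nth_valleys ltxh ltyh /= !andbF.
- move=> x _; rewrite /fits !nth_valleys ltnn subnn /=.
  by case: ltngtP => //=; rewrite ?andbF ?andbT.
move=> r x y ltrh _ _; rewrite /fits nth_valleys_bump nth_valleys_bump_lt //.
have -> : (if y.+1 == h then (false, false)
           else nth valley (nseq h valley ++ w) y).2
        = (nth valley (nseq h valley ++ w) y).2.
  by case: eqP => // <-; rewrite nth_valleys ltnSn.
rewrite !nth_valleys /bump.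
by case: (ltnP x h) => ltxh; case: (ltnP y h) => ltyh //=;
   rewrite ?andbF ?andbT //; lia.
Qed.

Lemma valleysS h (w : seq letter) :
  nseq h.+1 valley ++ w = nseq h valley ++ valley :: w.
Proof. by rewrite -addn1 nseqD -catA. Qed.

Lemma nth_valleysS_bump h (w : seq letter) c x : (c <= h)%N ->
  nth valley (nseq h.+1 valley ++ w) (bump c x) =
  nth valley (nseq h valley ++ w) x.
Proof.
rewrite valleysS leq_eqVlt => /predU1P[->|ltch]; first exact: nth_valleys_bump.
rewrite nth_valleys_bump_lt //; case: eqP => // <-.
by rewrite nth_valleys ltnSn.
Qed.

(** Two deletions: the value of the peak with an open position, then its position with an open
    value. The second costs [q ^+ h] because the row of the peak has by then moved to index [h]. *)
Lemma word_rinv_peak h w :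
  word_rinv (nseq h.+1 valley ++ (false, true) :: w) =
  q ^+ h.+1 * qnat h.+1 * (q ^+ h * qnat h.+1) * word_rinv (nseq h valley ++ w).
Proof.
pose v := nseq h.+1 valley ++ (false, true) :: w.
(* Row 0 stands for any of the [h.+1] open rows. [P] is the restriction of
   [nseq h valley ++ (false, false) :: w] with the cell [(h, h)] added, which gives row [h] its
   [h.+1] choices. *)
pose P x y := fits v (bump 0 x) (bump h.+1 y).
have PE x y : P x y =
    let a := (if x == h then (false, true)
              else nth valley (nseq h.+1 valley ++ w) x).1 in
    let b := (nth valley (nseq h.+1 valley ++ w) y).2 in
    [|| [&& x.+1 < bump h.+1 y, a & b]
      | [&& bump h.+1 y < x.+1, ~~ a & ~~ b]]%N.
  by rewrite /P /fits nth_valleys_bump nth_valleys_bump_lt.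
have sz_v : size v = (h + (size w).+1).+1 by rewrite size_cat /= size_nseq.
rewrite -mulrA -/v /word_rinv sz_v size_cat size_nseq.
transitivity (q ^+ h.+1 * qnat h.+1 * rinv (h + (size w).+1) P); last first.
  congr (_ * _); rewrite addnS; apply: rinv_row; try lia.
  - move=> x y ltxh ltyh.
    by rewrite PE !nth_valleys (leqW ltxh) ltyh ltn_eqF //= !andbF.
  - move=> y _; rewrite PE eqxx !nth_valleys /bump.
    by case: (ltnP y h.+1) => /=; lia.
  move=> c x y ltch _ _; rewrite PE.
  rewrite !nth_valleysS_bump // ifN_eqC ?neq_bump // /fits !nth_valleys /bump.
  by case: (ltnP x h) => ltxh; case: (ltnP y h) => ltyh //=;
     rewrite ?andbF ?andbT //; lia.
apply: rinv_col; try lia.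
- by move=> x y ltxh ltyh; rewrite /fits !nth_valleys ltxh ltyh /= !andbF.
- move=> x _; rewrite /fits !nth_valleys ltnn subnn /=.
  by case: ltngtP => //=; rewrite ?andbF ?andbT.
move=> r x y ltrh _ _.
rewrite /P /fits !nth_valleys_bump !nth_valleys_bump_lt //.
rewrite !nth_valleys /bump eqSS; case: eqP => [->|neqxh] /=.
  by lia.
by case: (ltnP x h.+1) => ltxh; case: (ltnP y h.+1) => ltyh //=;
   rewrite ?andbF ?andbT //; lia.
Qed.

Lemma word_rinv_peak0 w : word_rinv ((false, true) :: w) = 0.
Proof.
rewrite /word_rinv /rinv big_pred0 // => s.
apply/negP=> /forallP/(_ (s^-1%g ord0)).
by rewrite permKV /fits ltn0 /= !andbF.
Qed.

Lemma word_rinv_valleys h : word_rinv (nseq h.+1 valley) = 0.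
Proof.
rewrite /word_rinv size_nseq /rinv big_pred0 // => s.
apply/negP=> /forallP/(_ ord0).
by rewrite /fits !nth_nseq !if_same /= !andbF.
Qed.

Lemma word_rinv_nil : word_rinv [::] = 1.
Proof.
rewrite /word_rinv /rinv (big_pred1 1%g) => [|s].
  rewrite /invs (_ : [set _ | _] = set0) ?cards0 //.
  by apply/setP=> -[[]].
rewrite [RHS]inE (_ : s == 1%g); last by apply/eqP/permP=> -[].
by apply/forallP=> -[].
Qed.

(** * Weights of Motzkin paths *)

Fixpoint path_weight h (w : seq letter) : R :=
  match w with
  | [::] => (h == 0%N)%:R
  | (true, false) :: w' => path_weight h.+1 w'
  | (false, true) :: w' =>
    if h is h'.+1
    then q ^+ h * qnat h * (q ^+ h' * qnat h) * path_weight h' w' else 0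
  | _ :: w' => q ^+ h * qnat h * path_weight h w'
  end.

(** Reading from the left, a valley joins the prefix and any other letter is deleted at the cost of
    its factor. *)
Lemma word_rinvE h w : word_rinv (nseq h valley ++ w) = path_weight h w.
Proof.
elim: w h => [|[[] []] w IHw] h /=.
- by rewrite cats0; case: h => [|h]; rewrite ?word_rinv_valleys ?word_rinv_nil.
- by rewrite word_rinv_double_ascent IHw.
- by rewrite -IHw valleysS.
- by case: h => [|h]; rewrite ?word_rinv_peak0 ?word_rinv_peak ?IHw.
- by rewrite word_rinv_double_descent IHw.
Qed.

(** * The word of a derangement *)

Definition pword n (s : 'S_n) : n.-tuple letter :=
  [tuple (i < s i, s^-1%g i < i)%N | i < n].

Lemma nth_pword n (s : 'S_n) (i : 'I_n) :
  nth valley (pword s) i = ((i < s i)%N, (s^-1%g i < i)%N).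
Proof. by rewrite -tnth_nth tnth_mktuple. Qed.

Lemma fits_pword n (s : 'S_n) (w : n.-tuple letter) :
  [forall x : 'I_n, fits w x (s x)] = (s \in derangements n) && (pword s == w).
Proof.
rewrite inE.
apply/forallP/andP => [fits_s | [/forallP ds /eqP<-] x]; last first.
  rewrite /fits !nth_pword /= permK; have := ds x; rewrite -val_eqE /=.
  by case: ltngtP.
split.
  by apply/forallP=> x; apply: contraTneq (fits_s x) => ->; rewrite /fits ltnn.
apply/eqP/eq_from_tnth=> i; rewrite tnth_mktuple (tnth_nth valley).
(* The condition at [i] forces the first flag of letter [i], the condition at its preimage the
   second. *)
have := fits_s (s^-1%g i); have := fits_s i; rewrite /fits permKV.
case: (nth valley w i) => a b /= fits_a fits_b; congr (_, _).
  by case: a fits_a => /=; case: ltngtP.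
by case: b fits_b => /=; case: ltngtP; rewrite ?andbF.
Qed.

Lemma sum_pword n (C : pred (n.-tuple letter)) (f : n.-tuple letter -> R) :
  \sum_(s in derangements n | C (pword s)) q ^+ invs s * f (pword s) =
  \sum_(w : n.-tuple letter | C w) path_weight 0%N w * f w.
Proof.
rewrite (partition_big (@pword n) C) => [|s /andP[]//].
apply: eq_bigr => w Cw.
rewrite -word_rinvE /word_rinv /= size_tuple /rinv mulr_suml.
apply: eq_big => [s|s /andP[_ /eqP->] //]; rewrite fits_pword.
by case: eqP => [->|]; rewrite ?Cw ?andbT ?andbF.
Qed.

Definition nexc (w : seq letter) : nat := count fst w.

Lemma exc_pword n (s : 'S_n) : exc s = nexc (pword s).
Proof.
rewrite /exc cardsE cardE /enum_mem size_filter /nexc /= count_map enumT.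
by apply: eq_count.
Qed.

(** A double excedance [i < s i < s (s i)] is recorded by the letter at its middle term [s i]. *)
Lemma cda_pword n (s : 'S_n) : (cda s == 0%N) = ((true, true) \notin pword s).
Proof.
rewrite cards_eq0; apply/eqP/idP => [cda0 | nA].
  apply/tnthP=> -[i]; rewrite tnth_mktuple => -[/esym ltis /esym ltsi].
  by have := in_set0 (s^-1%g i); rewrite -cda0 inE permKV ltis ltsi.
apply/setP=> i; rewrite !inE; apply: contraNF nA => /andP[ltis ltss].
by apply/tnthP; exists (s i); rewrite tnth_mktuple permK ltis ltss.
Qed.

(** * Trading double ascents for factors [1 + t] *)

Lemma sum_tupleS n (F : seq letter -> R) :
  \sum_(w : n.+1.-tuple letter) F w =
  \sum_(w : n.-tuple letter) F ((true, true) :: w) +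
  \sum_(w : n.-tuple letter) F ((true, false) :: w) +
  (\sum_(w : n.-tuple letter) F ((false, true) :: w) +
   \sum_(w : n.-tuple letter) F ((false, false) :: w)).
Proof.
rewrite (reindex (fun p : letter * n.-tuple letter =>
  [tuple of p.1 :: p.2])) /=.
  rewrite -(pair_bigA _ (fun c (w : n.-tuple letter) => F (c :: w))) /=.
  pose G a b := \sum_(w : n.-tuple letter) F ((a, b) :: w).
  transitivity (\sum_(c : letter) G c.1 c.2); first by apply: eq_bigr => -[].
  by rewrite -(pair_bigA _ G) /= !big_bool.
exists (fun w => (thead w, [tuple of behead w])) => [[c w] _ | w _] /=.
  by rewrite theadE; congr pair; apply: val_inj.
by rewrite -tuple_eta.
Qed.

(** A path from height [h] to 0 has [h] more peaks than valleys, and without double ascents the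
    excedances are the valleys. The weight vanishes if the path drops below 0 or ends above it. *)
Lemma path_weight_balance h w :
    (true, true) \notin w ->
  path_weight h w = 0 \/
  size w = (2 * nexc w + h + count_mem (false, false) w)%N.
Proof.
elim: w h => [|[[] []] w IHw] h //=.
- by case: h => [|h]; [right|left].
- by rewrite inE => /(IHw h.+1)[->|->]; [left|right; rewrite /nexc /=; lia].
- case: h => [|h]; first by left.
  by rewrite inE => /(IHw h)[->|->]; [left; rewrite mulr0|
     right; rewrite /nexc /=; lia].
- by rewrite inE => /(IHw h)[->|->]; [left; rewrite mulr0|
     right; rewrite /nexc /=; lia].
Qed.

(** Induction on the length, for all heights at once since valleys and peaks change the height. A
    leading double ascent contributes [t] times what a double descent does; the right side gives the
    total [1 + t] to the descent alone. *)
Lemma sum_path_weight t h n :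
  \sum_(w : n.-tuple letter) path_weight h w * t ^+ nexc w =
  \sum_(w : n.-tuple letter | (true, true) \notin w)
    path_weight h w * (t ^+ nexc w * (1 + t) ^+ count_mem (false, false) w).
Proof.
rewrite [RHS]big_mkcond /=.
pose F h (w : seq letter) := path_weight h w * t ^+ nexc w.
pose G h (w : seq letter) := if (true, true) \notin w then
  path_weight h w * (t ^+ nexc w * (1 + t) ^+ count_mem (false, false) w) else 0.
rewrite -[LHS]/(\sum_(w : n.-tuple letter) F h w).
rewrite -[RHS]/(\sum_(w : n.-tuple letter) G h w).
elim: n h => [|n IHn] h.
  by apply: eq_bigr => w _; rewrite tuple0 /F /G /nexc /= !expr0 !mulr1.
have FA : \sum_(w : n.-tuple letter) F h ((true, true) :: w) =
          q ^+ h * qnat h * t * \sum_(w : n.-tuple letter) F h w.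
  rewrite mulr_sumr; apply: eq_bigr => w _.
  by rewrite /F /nexc /= add1n exprS; ring.
have FD : \sum_(w : n.-tuple letter) F h ((false, false) :: w) =
          q ^+ h * qnat h * \sum_(w : n.-tuple letter) F h w.
  by rewrite mulr_sumr; apply: eq_bigr => w _; rewrite /F mulrA.
have FV : \sum_(w : n.-tuple letter) F h ((true, false) :: w) =
          t * \sum_(w : n.-tuple letter) F h.+1 w.
  rewrite mulr_sumr; apply: eq_bigr => w _.
  by rewrite /F /nexc /= add1n exprS; ring.
have GA : \sum_(w : n.-tuple letter) G h ((true, true) :: w) = 0.
  by rewrite big1 // => w _; rewrite /G mem_head.
have GV : \sum_(w : n.-tuple letter) G h ((true, false) :: w) =
          t * \sum_(w : n.-tuple letter) G h.+1 w.
  rewrite mulr_sumr; apply: eq_bigr => w _; rewrite /G /nexc in_cons /=.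
  by case: ifP => _; rewrite ?mulr0 // add0n add1n exprS; ring.
have GD : \sum_(w : n.-tuple letter) G h ((false, false) :: w) =
          q ^+ h * qnat h * (1 + t) * \sum_(w : n.-tuple letter) G h w.
  rewrite mulr_sumr; apply: eq_bigr => w _; rewrite /G /nexc in_cons /=.
  by case: ifP => _; rewrite ?mulr0 // add0n add1n exprS; ring.
(* At height 0 both sides vanish; otherwise induction applies one level down. *)
have FP : \sum_(w : n.-tuple letter) F h ((false, true) :: w) =
          \sum_(w : n.-tuple letter) G h ((false, true) :: w).
  case: h {FA FD FV GA GV GD} => [|h].
    by apply: eq_bigr => w _; rewrite /F /G /= !mul0r if_same.
  pose c := q ^+ h.+1 * qnat h.+1 * (q ^+ h * qnat h.+1).
  transitivity (c * \sum_(w : n.-tuple letter) F h w).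
    by rewrite mulr_sumr; apply: eq_bigr => w _; rewrite /F [RHS]mulrA.
  rewrite IHn mulr_sumr; apply: eq_bigr => w _.
  by rewrite /G in_cons /=; case: ifP => _; rewrite ?mulr0 // [LHS]mulrA.
by rewrite !sum_tupleS FA FV FP FD GA GV GD !IHn; ring.
Qed.

End RestrictedInversionSum.

(** * Grouping the words by number of excedances *)

Theorem theorem2 (R : comNzRingType) (q t : R) (n : nat) (hn : (1 <= n)%N) :
  \sum_(s in derangements n) q ^+ invs s * t ^+ exc s =
  \sum_(0 <= k < (n %/ 2).+1)
    (\sum_(s in DE n k) q ^+ invs s) * t ^+ k * (1 + t) ^+ (n - 2 * k).
Proof.
have -> : \sum_(s in derangements n) q ^+ invs s * t ^+ exc s =
    \sum_(w : n.-tuple letter) path_weight q 0%N w * t ^+ nexc w.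
  rewrite -(sum_pword q predT (fun w => t ^+ nexc w)).
  by apply: eq_big => [s|s _]; rewrite ?andbT // exc_pword.
have DEE k : \sum_(s in DE n k) q ^+ invs s =
    \sum_(w : n.-tuple letter | ((true, true) \notin w) && (nexc w == k))
      path_weight q 0%N w.
  (* The factor 1 brings the sum to the form of [sum_pword]. *)
  transitivity (\sum_(w : n.-tuple letter |
      ((true, true) \notin w) && (nexc w == k)) path_weight q 0%N w * 1).
    rewrite -(sum_pword q (fun w : n.-tuple letter =>
      ((true, true) \notin w) && (nexc w == k)) (fun=> 1)).
    apply: eq_big => [s|s _]; last by rewrite mulr1.
    by rewrite [LHS]inE exc_pword cda_pword [(nexc _ == k) && _]andbC.
  by apply: eq_bigr => w _; rewrite mulr1.
under [RHS]eq_bigr => k _ do rewrite DEE !mulr_suml.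
rewrite sum_path_weight.
rewrite (exchange_big_dep (fun w : n.-tuple letter => (true, true) \notin w));
  last by move=> k w _ /andP[].
apply: eq_bigr => w nA; rewrite big_mkord.
under eq_bigl => k do rewrite nA /=.
(* A word of weight 0 may have more than [n / 2] excedances and so match no [k]; both sides are then
   0. *)
have [->|] := path_weight_balance q 0%N nA.
  by rewrite mul0r big1 // => k _; rewrite !mul0r.
have half_sub m e d :
    m = (2 * e + d)%N -> (e < (m %/ 2).+1)%N /\ d = (m - 2 * e)%N by lia.
rewrite size_tuple addn0 => /half_sub[lt_w des_w].
(* Only [k = nexc w] contributes, and [lt_w] places it in the range. *)
rewrite (big_pred1 (Ordinal lt_w)) => [|k]; last by rewrite /= -val_eqE eq_sym.
by rewrite mulrA; congr (_ * _ ^+ _); apply: des_w.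
Qed.
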